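(* There is a constant $C$ such that every connected finite simple graph $G$ with $n\ge 3$ vertices which has dimension at most $3$ or admits a realizer of the form $\{\pi_1,\pi_2,\pi_3,\overline{\pi_3}\}$ has at most $\frac{1}{4}n^2+Cn$ edges.
   Context: For a finite simple graph $G=(V,E)$, a realizer is a nonempty family $\mathcal{R}$ of linear orders of $V$ such that for every edge $S\in E$ and every vertex $x\in V\setminus S$ there is some $\pi\in\mathcal{R}$ with $x>y$ in $\pi$ for every $y\in S$. The dimension of $G$ is the least size of a realizer. For a linear order $\pi$, $\overline{\pi}$ denotes its reverse. A graph with dimension at most 3 or with a realizer $\{\pi_1,\pi_2,\pi_3,\overline{\pi_3}\}$ is said to have dimension at most $\langle 3\to 4\rangle$. *)

(* Defs.v *)
From mathcomp Require Import all_boot.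

Set Implicit Arguments.
Unset Strict Implicit.
Unset Printing Implicit Defensive.

Definition simple_graph (V : finType) (E : {set {set V}}) : Prop :=
  forall S, S \in E -> #|S| = 2.

Definition adjacent (V : finType) (E : {set {set V}}) : rel V :=
  [rel x y | [set x; y] \in E].

Definition connected_graph (V : finType) (E : {set {set V}}) : Prop :=
  forall x y : V, connect (adjacent E) x y.

(* (x, y) \in r reads x <= y; totality, taken at x = y, gives reflexivity. *)
Definition is_linear_order (V : finType) (r : {set V * V}) : bool :=
  [&& [forall x, forall y, ((x, y) \in r) || ((y, x) \in r)],
      [forall x, forall y, ((x, y) \in r) && ((y, x) \in r) ==> (x == y)]
    & [forall x, forall y, forall z,
         ((x, y) \in r) && ((y, z) \in r) ==> ((x, z) \in r)]].

Definition linorder (V : finType) := {r : {set V * V} | is_linear_order r}.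

Definition lo_lt (V : finType) (p : linorder V) (x y : V) : bool :=
  (x != y) && ((x, y) \in val p).

Lemma lo_rev_subproof (V : finType) (p : linorder V) :
  is_linear_order [set xy : V * V | (xy.2, xy.1) \in val p].
Proof.
case: p => r /= /and3P[/forallP tot /forallP anti /forallP trans].
apply/and3P; split; apply/forallP => x; apply/forallP => y.
- by rewrite !inE /=; exact: (forallP (tot y) x).
- by rewrite !inE /= andbC; exact: (forallP (anti x) y).
- apply/forallP => z; rewrite !inE /= andbC.
  exact: (forallP (forallP (trans z) y) x).
Qed.

Definition lo_rev (V : finType) (p : linorder V) : linorder V :=
  Sub [set xy : V * V | (xy.2, xy.1) \in val p] (lo_rev_subproof p).

Definition realizer (V : finType) (E : {set {set V}})
    (R : {set linorder V}) : bool :=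
  (R != set0) &&
  [forall S in E, forall x in ~: S,
     [exists p in R, forall y in S, lo_lt p y x]].

Lemma linear_order_of_inj (V : finType) (f : V -> nat) :
  injective f -> is_linear_order [set xy : V * V | f xy.1 <= f xy.2].
Proof.
move=> inj_f; apply/and3P; split; apply/forallP => x; apply/forallP => y.
- by rewrite !inE /= leq_total.
- by rewrite !inE /= -eqn_leq (inj_eq inj_f) implybb.
- apply/forallP => z; rewrite !inE /=; apply/implyP => /andP[].
  exact: leq_trans.
Qed.

Lemma realizer_setT (V : finType) (E : {set {set V}}) :
  realizer E [set: linorder V].
Proof.
have rank_inj : injective (fun x : V => enum_rank x : nat).
  by move=> x y /val_inj/enum_rank_inj.
apply/andP; split.
  apply/set0Pn.
  by exists (Sub _ (linear_order_of_inj rank_inj) : linorder V); rewrite inE.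
apply/forall_inP => S _; apply/forall_inP => x; rewrite inE => xNS.
pose f y := if y == x then #|V| else enum_rank y.
have f_inj : injective f.
  move=> y z; rewrite /f; case: eqP => [->|_]; case: eqP => [->|_] //.
  - by move=> eq_z; have := ltn_ord (enum_rank z); rewrite -eq_z ltnn.
  - by move=> eq_y; have := ltn_ord (enum_rank y); rewrite eq_y ltnn.
  - exact: rank_inj.
apply/exists_inP.
exists (Sub _ (linear_order_of_inj f_inj) : linorder V); rewrite ?inE //.
apply/forall_inP => y yS; have yNx : y != x by apply: contraNneq xNS => <-.
rewrite /lo_lt yNx /= !inE /= /f eqxx (negbTE yNx).
by rewrite ltnW // ltn_ord.
Qed.

Lemma realizer_size_exists (V : finType) (E : {set {set V}}) :
  exists k, [exists R : {set linorder V}, realizer E R && (#|R| == k)].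
Proof.
exists #|[set: linorder V]|; apply/existsP; exists [set: linorder V].
by rewrite realizer_setT eqxx.
Qed.

Definition dimension (V : finType) (E : {set {set V}}) : nat :=
  ex_minn (realizer_size_exists E).

Definition dim_at_most_3to4 (V : finType) (E : {set {set V}}) : Prop :=
  dimension E <= 3 \/
  exists p1 p2 p3 : linorder V, realizer E [set p1; p2; p3; lo_rev p3].

(* Main.v *)
Require Import Defs.
From mathcomp Require Import all_boot all_order all_algebra.
From mathcomp Require Import reals.
From mathcomp Require Import zify lra.

(** A realizer with at most three orders extends to one of the form
    {p1, p2, p3, rev p3}, so only the latter case matters.  Let a, b, c be the
    ranks in p1, p2, p3.  The realizer says that a vertex c-between the ends of
    an edge is above both ends in a or in b.  If y dominates x in both a and b
    for an edge x <_c y, then x is the c-last vertex before y dominated by y, so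
    there are at most n such edges, and symmetrically when x dominates y.  On
    the remaining edges a and b disagree, and then an edge is the c-longest side
    of at most two triangles, one whose middle vertex is high in a and one
    whose middle vertex is high in b.  Hence the c-longest of these edges lies
    in at most two triangles, and Mantel's induction, deleting the two ends of
    that edge, gives n^2/4 + O(n). *)

Import Order.TTheory GRing.Theory Num.Theory.
Local Open Scope ring_scope.

Set Implicit Arguments.
Unset Strict Implicit.
Unset Printing Implicit Defensive.

Local Open Scope nat_scope.

(** * Mantel's induction for oriented graphs with an arc in few triangles *)

Definition arcs_in (V : finType) (e : rel V) (U : {set V}) : {set V * V} :=
  [set p in setX U U | e p.1 p.2].

Definition neighbours_in (V : finType) (e : rel V) (U : {set V}) (x : V) :=
  [set w in U | e x w || e w x].

Lemma in_neighbours (V : finType) (e : rel V) (U : {set V}) (x w : V) :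
  (w \in neighbours_in e U x) = (w \in U) && (e x w || e w x).
Proof. by rewrite inE. Qed.

Lemma card_arcs_in_setD2 (V : finType) (e : rel V) (U : {set V}) (x y : V) :
  irreflexive e -> (forall u v, e u v -> ~~ e v u) -> e x y ->
  #|arcs_in e U| <= #|arcs_in e (U :\: [set x; y])| + 1
    + (#|neighbours_in e (U :\: [set x; y]) x|
       + #|neighbours_in e (U :\: [set x; y]) y|).
Proof.
move=> eirr easym exy; set W := U :\: [set x; y].
(* [arc u w] orients the pair as [e] does, so each arc joining [x] or [y] to [W] is the image of a
   neighbour in [W]. *)
pose arc u w := if e u w then (u, w) else (w, u).
have sub : arcs_in e U \subset
    arcs_in e W :|: [set (x, y)]
      :|: (arc x @: neighbours_in e W x :|: arc y @: neighbours_in e W y).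
  apply/subsetP => -[u v]; rewrite !inE /= => /andP[/andP[uU vU] euv].
  have nvu := easym _ _ euv.
  have nyx := easym _ _ exy.
  case: (boolP (u \in [set x; y])) => uxy.
    case: (boolP (v \in [set x; y])) => vxy.
      suff -> : (u, v) = (x, y) by rewrite eqxx !orbT.
      move: uxy vxy euv; rewrite !inE.
      by move=> /orP[]/eqP-> /orP[]/eqP->; rewrite ?eirr ?(negbTE nyx).
    have vN : v \in neighbours_in e W u.
      by rewrite inE in_setD vxy vU euv.
    have -> : (u, v) = arc u v by rewrite /arc euv.
    by move: uxy vN; rewrite !inE => /orP[]/eqP-> vN;
      rewrite imset_f ?inE ?vN ?orbT.
  case: (boolP (v \in [set x; y])) => vxy.
    have uN : u \in neighbours_in e W v.
      by rewrite inE in_setD uxy uU euv orbT.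
    have -> : (u, v) = arc v u by rewrite /arc (negbTE nvu).
    by move: vxy uN; rewrite !inE => /orP[]/eqP-> uN;
      rewrite imset_f ?inE ?uN ?orbT.
  by move: uxy vxy; rewrite !inE => -> ->; rewrite uU vU euv.
apply: (leq_trans (subset_leq_card sub)).
apply: (leq_trans (leq_card_setU _ _)).
apply: leq_add.
  by apply: (leq_trans (leq_card_setU _ _)); rewrite cards1.
apply: (leq_trans (leq_card_setU _ _)).
by apply: leq_add; apply: leq_imset_card.
Qed.

(** Let [W] be [U] without the ends of the chosen arc. The degrees of the two ends into [W] add up
    to the union plus the intersection of their neighbourhoods, so at most [1 + |W| + k] arcs are
    lost. As [|U| = |W| + 2], four times this is exactly the growth of the bound from [W] to [U]. *)
Lemma card_arcs_in_few_triangles (V : finType) (e : rel V) (k : nat) :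
  irreflexive e -> (forall u v, e u v -> ~~ e v u) ->
  (forall U : {set V}, arcs_in e U != set0 ->
     exists x y, [/\ x \in U, y \in U, e x y &
       #|neighbours_in e U x :&: neighbours_in e U y| <= k]) ->
  forall U : {set V}, 4 * #|arcs_in e U| <= #|U| ^ 2 + 2 * k * #|U|.
Proof.
move=> eirr easym few U.
have [n] := ubnP #|U|; elim: n U => // n IHn U ltUn.
have [->|/few[x [y [xU yU exy cxy]]]] := eqVneq (arcs_in e U) set0.
  by rewrite cards0.
have xNy : x != y by apply: contraTneq exy => ->; rewrite eirr.
have sxyU : [set x; y] \subset U by rewrite subUset !sub1set xU yU.
have := card_arcs_in_setD2 U eirr easym exy.
set W := U :\: [set x; y] => arcsU.
have cardW : #|U| = #|W| + 2.
  by rewrite -(cardsID [set x; y] U) (setIidPr sxyU) cards2 xNy addnC.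
have /IHn IHW : #|W| < n by lia.
have sWU z : neighbours_in e W z \subset neighbours_in e U z.
  by apply/subsetP => w; rewrite !inE => /andP[/andP[_ ->]].
have cap := subset_leq_card (setISS (sWU x) (sWU y)).
have cup : #|neighbours_in e W x :|: neighbours_in e W y| <= #|W|.
  apply/subset_leq_card; rewrite subUset.
  by apply/andP; split; apply/subsetP => w; rewrite in_neighbours => /andP[].
have := cardsUI (neighbours_in e W x) (neighbours_in e W y).
nia.
Qed.

(** * Arcs going up in one rank, sorted by their behaviour in the other two *)

Section ThreeRanks.

Context {V : finType} {a b c : V -> nat} {e : rel V}.
Hypotheses (a_inj : injective a) (b_inj : injective b) (c_inj : injective c).
Hypothesis e_lt : forall {x y}, e x y -> c x < c y.
Hypothesis e_between : forall {x y z}, e x y -> c x < c z -> c z < c y ->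
  (a x < a z /\ a y < a z) \/ (b x < b z /\ b y < b z).

(** The head determines the tail: of two tails of [y], the [c]-later one lies between the other and
    [y], so it would exceed [y] in [a] or [b]. *)
Lemma card_increasing_arcs :
  #|[set p : V * V | [&& e p.1 p.2, a p.1 < a p.2 & b p.1 < b p.2]]| <= #|V|.
Proof.
rewrite -(@card_in_imset _ _ snd); first exact: max_card.
move=> [x y] [x' y']; rewrite !inE /= => /and3P[exy axy bxy].
move=> /and3P[ex'y ax'y bx'y] yy'; rewrite -yy' in ex'y ax'y bx'y *.
congr (_, _); apply: c_inj.
have := e_lt exy; have := e_lt ex'y.
have := @e_between x y x' exy; have := @e_between x' y x ex'y.
lia.
Qed.

(** The tail determines the head: of two heads of [x], the [c]-earlier one lies between [x] and the
    other, so it would exceed [x] in [a] or [b]. *)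
Lemma card_decreasing_arcs :
  #|[set p : V * V | [&& e p.1 p.2, a p.2 < a p.1 & b p.2 < b p.1]]| <= #|V|.
Proof.
rewrite -(@card_in_imset _ _ fst); first exact: max_card.
move=> [x y] [x' y']; rewrite !inE /= => /and3P[exy axy bxy].
move=> /and3P[exy' axy' bxy'] xx'; rewrite -xx' in exy' axy' bxy' *.
congr (_, _); apply: c_inj.
have := e_lt exy; have := e_lt exy'.
have := @e_between x y y' exy; have := @e_between x y' y exy'.
lia.
Qed.

Definition mixed_arc : rel V :=
  [rel x y | e x y && ((a x < a y) (+) (b x < b y))].

Lemma mixed_arc_lt x y : mixed_arc x y -> c x < c y.
Proof. by case/andP=> /e_lt. Qed.

Lemma card_mixed_middle x y :
  e x y -> #|[set w | mixed_arc x w && mixed_arc w y]| <= 2.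
Proof.
move=> exy; set M := [set w | _].
suff [cA cB] : #|[set w in M | (a x < a w) && (a y < a w)]| <= 1 /\
    #|[set w in M | (b x < b w) && (b y < b w)]| <= 1.
  apply: (@leq_trans (1 + 1)) => //.
  apply: leq_trans (leq_add cA cB); apply: leq_trans (leq_card_setU _ _).
  apply/subset_leq_card/subsetP => w wM; rewrite !inE in wM *.
  rewrite wM /=; case/andP: wM => /mixed_arc_lt xw /mixed_arc_lt wy.
  by case: (e_between exy xw wy) => -[-> ->]; rewrite ?orbT.
(* Let [u] precede [v] in [c], both above [x] and [y] in [a]. Mixedness puts both below [x] and [y]
   in [b]. Then [e_between] for the arc from [x] to [v] forces [a v < a u], and for the arc from [u]
   to [y] it forces [a u < a v]. The case of [b] is symmetric. *)
split; apply/card_le1_eqP => u v; rewrite !inE => /andP[/andP[]];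
  rewrite /= => /andP[exu xu] /andP[euy uy] hu /andP[/andP[]];
  move=> /andP[exv xv] /andP[evy vy] hv; apply: c_inj;
  have := e_lt exu; have := e_lt euy; have := e_lt exv; have := e_lt evy;
  have := @e_between x u v exu; have := @e_between x v u exv;
  have := @e_between u y v euy; have := @e_between v y u evy;
  lia.
Qed.

(** For a [c]-longest arc, a common neighbour outside its [c]-interval would form a longer arc with
    the farther end, so every common neighbour is a middle vertex. *)
Lemma exists_mixed_arc_few_triangles (U : {set V}) :
  arcs_in mixed_arc U != set0 ->
  exists x y, [/\ x \in U, y \in U, mixed_arc x y &
    #|neighbours_in mixed_arc U x :&: neighbours_in mixed_arc U y| <= 2].
Proof.
case/set0Pn => p0 p0U.
(* Truncated subtraction is exact on these arcs, as [c] increases along them. *)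
have [[x y] xyU longest] :=
  arg_maxnP (fun p : V * V => c p.2 - c p.1) p0U.
have {}longest u v : u \in U -> v \in U -> mixed_arc u v ->
    c v - c u <= c y - c x.
  move=> uU vU euv; have : (u, v) \in arcs_in mixed_arc U.
    by rewrite inE in_setX /= uU vU.
  exact: longest.
have : (x, y) \in arcs_in mixed_arc U by [].
rewrite inE in_setX => /andP[/andP[/= xU yU] mxy].
exists x, y; split => //.
have /andP[exy _] := mxy.
apply: leq_trans (card_mixed_middle exy).
apply/subset_leq_card/subsetP => w.
rewrite in_setI !in_neighbours => /andP[/andP[wU wx] /andP[_ wy]].
have xy := mixed_arc_lt mxy.
rewrite inE; case/orP: wx => wx; case/orP: wy => wy;
  have := mixed_arc_lt wx; have := mixed_arc_lt wy => cwy cwx.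
- by have := longest _ _ xU wU wx; clear -cwx cwy xy; lia.
- exact/andP.
- by clear -cwx cwy xy; lia.
- by have := longest _ _ wU yU wy; clear -cwx cwy xy; lia.
Qed.

Lemma card_mixed_arcs :
  4 * #|[set p : V * V | mixed_arc p.1 p.2]| <= #|V| ^ 2 + 4 * #|V|.
Proof.
have -> : [set p : V * V | mixed_arc p.1 p.2] = arcs_in mixed_arc setT.
  by apply/setP => p; rewrite !inE.
rewrite -cardsT; apply: (@card_arcs_in_few_triangles _ _ 2).
- by move=> x; apply/negP => /mixed_arc_lt; rewrite ltnn.
- by move=> x y /mixed_arc_lt xy; apply/negP => /mixed_arc_lt; lia.
- exact: exists_mixed_arc_few_triangles.
Qed.

(** The coefficient 12 collects 4 each from the increasing, decreasing and mixed arcs. *)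
Lemma card_arcs_three_ranks :
  4 * #|[set p : V * V | e p.1 p.2]| <= #|V| ^ 2 + 12 * #|V|.
Proof.
have := card_mixed_arcs.
have := card_increasing_arcs; have := card_decreasing_arcs.
set D := [set p | _]; set I := [set p | _]; set M := [set p | _].
suff /subset_leq_card : [set p : V * V | e p.1 p.2] \subset I :|: D :|: M.
  have := (leq_card_setU (I :|: D) M).1; have := (leq_card_setU I D).1.
  lia.
apply/subsetP => -[x y]; rewrite !inE /mixed_arc /= => exy; rewrite exy /=.
have xNy : x != y by apply: contraTneq (e_lt exy) => ->; rewrite ltnn.
have := xNy; rewrite -(inj_eq a_inj) => aNxy.
have := xNy; rewrite -(inj_eq b_inj) => bNxy.
lia.
Qed.

End ThreeRanks.

(** * Ranks of linear orders, and the normal form of a realizer *)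

Lemma linorder_rank (V : finType) (p : linorder V) :
  exists2 f : V -> nat, injective f & forall x y, lo_lt p x y = (f x < f y).
Proof.
have /and3P[/forallP tot /forallP anti /forallP trans] := valP p.
have lt_total x y : x != y -> lo_lt p x y || lo_lt p y x.
  rewrite /lo_lt (eq_sym y) => -> /=; exact: (forallP (tot x) y).
have lt_irr x : lo_lt p x x = false by rewrite /lo_lt eqxx.
have lt_asym x y : lo_lt p x y -> ~~ lo_lt p y x.
  move=> /andP[xNy xy]; apply/negP => /andP[_ yx].
  by have /implyP := forallP (anti x) y; rewrite xy yx (negbTE xNy) => /(_ isT).
have lt_trans x y z : lo_lt p x y -> lo_lt p y z -> lo_lt p x z.
  move=> xy yz; apply/andP; split.
    by apply: contraTneq yz => <-; exact: lt_asym.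
  have /implyP := forallP (forallP (trans x) y) z; apply.
  by case/andP: xy => _ ->; case/andP: yz.
pose f x := #|[set y | lo_lt p y x]|.
have f_lt x y : lo_lt p x y -> f x < f y.
  move=> xy; apply/proper_card/properP; split.
    by apply/subsetP => z; rewrite !inE => /lt_trans; exact.
  by exists x; rewrite inE ?lt_irr.
exists f.
  move=> x y; case: (eqVneq x y) => // /lt_total/orP[]/f_lt; lia.
move=> x y; apply/idP/idP => [/f_lt //|fxy].
have xNy : x != y by apply: contraTneq fxy => ->; rewrite ltnn.
by case/orP: (lt_total _ _ xNy) => // /f_lt; lia.
Qed.

Lemma lo_lt_rev (V : finType) (p : linorder V) (x y : V) :
  lo_lt (lo_rev p) x y = lo_lt p y x.
Proof. by rewrite /lo_lt /= inE eq_sym. Qed.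

Lemma realizerS (V : finType) (E : {set {set V}}) (R R' : {set linorder V}) :
  R \subset R' -> realizer E R -> realizer E R'.
Proof.
move=> sRR' /andP[/set0Pn[p pR] /forall_inP real]; apply/andP; split.
  by apply/set0Pn; exists p; apply: (subsetP sRR').
apply/forall_inP => S /real/forall_inP realS; apply/forall_inP => x /realS.
case/exists_inP => q qR qS; apply/exists_inP.
by exists q => //; apply: (subsetP sRR').
Qed.

Lemma card_le3_sub (T : finType) (A : {set T}) :
  A != set0 -> #|A| <= 3 -> exists x y z, A \subset [set x; y; z].
Proof.
case/set0Pn => x0 _ cA; set s := enum A.
(* The default [x0] fills the missing places when [A] has fewer than three elements. *)
exists (nth x0 s 0), (nth x0 s 1), (nth x0 s 2).
apply/subsetP => x xA; rewrite !inE.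
have xs : x \in s by rewrite mem_enum.
have := xs; rewrite -index_mem -cardE => /leq_trans/(_ cA) lt3.
rewrite -(nth_index x0 xs).
by case: (index x s) lt3 => [|[|[|]]] //; rewrite eqxx ?orbT.
Qed.

Lemma dim_at_most_3to4_realizer (V : finType) (E : {set {set V}}) :
  dim_at_most_3to4 E ->
  exists p1 p2 p3, realizer E [set p1; p2; p3; lo_rev p3].
Proof.
case=> //; rewrite /dimension; case: ex_minnP => k.
case/existsP => R /andP[realR /eqP <-] _ cR.
have [R0 _] := andP realR.
have [p1 [p2 [p3 sR]]] := card_le3_sub R0 cR.
exists p1, p2, p3; apply: realizerS realR.
exact: subset_trans sR (subsetUl _ _).
Qed.

(** * From edges to arcs, and the final bound *)

Lemma card_edges_le_arcs (V : finType) (E : {set {set V}}) (c : V -> nat) :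
  injective c -> simple_graph E ->
  #|E| <= #|[set p : V * V | (c p.1 < c p.2) && ([set p.1; p.2] \in E)]|.
Proof.
move=> c_inj simpleE; set P := [set p | _].
apply: (@leq_trans #|[set [set p.1; p.2] | p in P]|); last first.
  exact: leq_imset_card.
apply/subset_leq_card/subsetP => S SE.
have /eqP/cards2P[x [y [xNy eS]]] := simpleE S SE; apply/imsetP.
have [cxy|cyx|/c_inj eqxy] := ltngtP (c x) (c y).
- by exists (x, y) => //; rewrite inE /= cxy -eS.
- by exists (y, x); rewrite ?inE /= 1?setUC // cyx -eS.
- by rewrite eqxy eqxx in xNy.
Qed.

Lemma card_edges_dim_at_most_3to4 (V : finType) (E : {set {set V}}) :
  simple_graph E -> dim_at_most_3to4 E -> 4 * #|E| <= #|V| ^ 2 + 12 * #|V|.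
Proof.
move=> simpleE /dim_at_most_3to4_realizer[p1 [p2 [p3 /andP[_ real]]]].
have [a a_inj ltE1] := linorder_rank p1.
have [b b_inj ltE2] := linorder_rank p2.
have [c c_inj ltE3] := linorder_rank p3.
pose e := [rel x y | (c x < c y) && ([set x; y] \in E)].
apply: leq_trans (leq_mul (leqnn 4) (card_edges_le_arcs c_inj simpleE)) _.
apply: (@card_arcs_three_ranks V a b c e) => // [x y /andP[]//|x y z].
move=> /andP[_ xyE] xz zy.
have /forall_inP/(_ _ xyE)/forall_inP/(_ z) := real.
have zNxy : z \in ~: [set x; y].
  by rewrite !inE negb_or; apply/andP; split; apply/eqP => zE;
    rewrite zE ltnn in xz zy.
move=> /(_ zNxy)/exists_inP[p pR /forall_inP above].
have := above x; have := above y; rewrite !inE !eqxx orbT => /(_ isT) py /(_ isT).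
(* As [z] is [c]-between, it is below [y] in [p3] and below [x] in the reverse, so only [p1] and
   [p2] can put it above both. *)
move: py; move: pR; rewrite !inE => /orP[/orP[/orP[]|]|] /eqP->;
  rewrite ?lo_lt_rev ?ltE1 ?ltE2 ?ltE3; lia.
Qed.

Local Close Scope nat_scope.

Unset Implicit Arguments.
Set Strict Implicit.
Set Printing Implicit Defensive.

Theorem theorem7 (R : realType) :
  exists C : R, forall (V : finType) (E : {set {set V}}),
    simple_graph E -> connected_graph E -> (3 <= #|V|)%N ->
    dim_at_most_3to4 E ->
    #|E|%:R <= 1 / 4 * #|V|%:R ^+ 2 + C * #|V|%:R.
Proof.
(* The constant is 12 / 4. *)
exists 3 => V E simpleE _ _ dimE.
have := card_edges_dim_at_most_3to4 simpleE dimE.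
rewrite -(ler_nat R) natrD natrX !natrM; lra.
Qed.
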